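(* Let $w=y_1\ldots y_k$ and $v=x_1\ldots x_n$ be non-empty words over $\{0,1\}$ with $y_k\ne x_n$. If $k\ne1$ or $n\ne1$, then $\mathfrak{K}(w,v)$ contains every finite $2$-group as a subgroup (up to isomorphism). In particular, it contains torsion elements of arbitrarily large order.
   Context: Automorphisms of the binary rooted tree $\{0,1\}^*$ act on the right. $\langle\langle g_0,g_1\rangle\rangle$ denotes the automorphism $0u\mapsto0u^{g_0}$, $1u\mapsto1u^{g_1}$; $\sigma$ exchanges $0$ and $1$ in the first letter; $\langle\langle g_0,g_1\rangle\rangle\sigma$ means first apply $\langle\langle g_0,g_1\rangle\rangle$, then $\sigma$. $\mathfrak{K}(w,v)$ is the subgroup of $\mathrm{Aut}(\{0,1\}^* )$ generated by $b_1,\dots,b_k,a_1,\dots,a_n$, where $b_1=\sigma$; for $1\le j<k$, $b_{j+1}=\langle\langle b_j,1\rangle\rangle$ if $y_j=0$ and $\langle\langle1,b_j\rangle\rangle$ if $y_j=1$; $a_1=\langle\langle b_k,a_n\rangle\rangle$ if $y_k=0,x_n=1$ and $a_1=\langle\langle a_n,b_k\rangle\rangle$ if $y_k=1,x_n=0$; for $1\le i<n$, $a_{i+1}=\langle\langle a_i,1\rangle\rangle$ if $x_i=0$ and $\langle\langle1,a_i\rangle\rangle$ if $x_i=1$. *)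

(* Defs.v *)
From HB Require Import structures.
From mathcomp Require Import all_boot all_fingroup all_solvable.
From mathcomp Require Import boolp classical_sets.

Set Implicit Arguments.
Unset Strict Implicit.
Unset Printing Implicit Defensive.

Local Open Scope group_scope.

(* The vertices of the binary rooted tree are the words in [seq bool] (0 is
   [false], 1 is [true]); the root is [::] and the children of u are the
   [rcons u x].  Since [aut_fun] is bijective and fixes the root, preserving
   parent-child edges one way makes it an automorphism of the rooted tree (see
   [aut_inverse]).  The inverse map is determined by [aut_fun]. *)
Record tree_aut := TreeAut {
  aut_fun :> seq bool -> seq bool;
  aut_inv : seq bool -> seq bool;
  aut_funK : cancel aut_fun aut_inv;
  aut_invK : cancel aut_inv aut_fun;
  aut_root : aut_fun [::] = [::];
  aut_child : forall u x, exists y, aut_fun (rcons u x) = rcons (aut_fun u) y }.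

Lemma tree_autP (g h : tree_aut) : g =1 h -> g = h.
Proof.
case: g h => [f fi fK fiK fr fc] [f' fi' fK' fiK' fr' fc'] /= /funext e.
subst f'.
have {}e : fi = fi' by apply/funext => u; rewrite -[u in RHS]fiK fK'.
by subst fi'; congr TreeAut; exact: Prop_irrelevance.
Qed.

HB.instance Definition _ := gen_eqMixin tree_aut.
HB.instance Definition _ := gen_choiceMixin tree_aut.

Definition aut_one : tree_aut.
Proof. by apply: (@TreeAut id id) => // u x; exists x. Defined.

(* Automorphisms act on the right: g * h is "first g, then h". *)
Definition aut_mul (g h : tree_aut) : tree_aut.
Proof.
apply: (@TreeAut (h \o g) (aut_inv g \o aut_inv h)).
- exact: can_comp (aut_funK h) (aut_funK g).
- exact: can_comp (aut_invK g) (aut_invK h).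
- by rewrite /= !aut_root.
- move=> u x; have [y /= ->] := aut_child g u x; exact: aut_child.
Defined.

Definition aut_inverse (g : tree_aut) : tree_aut.
Proof.
apply: (@TreeAut (aut_inv g) g (aut_invK g) (aut_funK g)).
- by rewrite -[in LHS](aut_root g) aut_funK.
- move=> u x; case: (lastP (aut_inv g (rcons u x))) (aut_invK g (rcons u x)).
    by rewrite aut_root => /(congr1 size); rewrite size_rcons.
  move=> s y; have [z ->] := aut_child g s y.
  by move=> /rcons_inj[<- _]; exists y; rewrite aut_funK.
Defined.

Lemma aut_mulA : associative aut_mul.
Proof. by move=> f g h; apply: tree_autP. Qed.
Lemma aut_mul1g : left_id aut_one aut_mul.
Proof. by move=> g; apply: tree_autP. Qed.
Lemma aut_mulg1 : right_id aut_one aut_mul.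
Proof. by move=> g; apply: tree_autP. Qed.
Lemma aut_mulVg : left_inverse aut_one aut_inverse aut_mul.
Proof. by move=> g; apply: tree_autP => u; exact: aut_invK. Qed.
Lemma aut_mulgV : right_inverse aut_one aut_inverse aut_mul.
Proof. by move=> g; apply: tree_autP => u; exact: aut_funK. Qed.

HB.instance Definition _ := isGroup.Build tree_aut
  aut_mulA aut_mul1g aut_mulg1 aut_mulVg aut_mulgV.

Definition swap_fun (u : seq bool) : seq bool :=
  if u is z :: u' then ~~ z :: u' else [::].

Definition aut_sigma : tree_aut.
Proof.
apply: (@TreeAut swap_fun swap_fun) => //.
- by case=> //= z u; rewrite negbK.
- by case=> //= z u; rewrite negbK.
- by case=> [|z u] x; [exists (~~ x) | exists x].
Defined.

Definition pair_fun (g0 g1 : seq bool -> seq bool) (u : seq bool) : seq bool :=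
  if u is z :: u' then z :: (if z then g1 u' else g0 u') else [::].

(* <<g0, g1>> : 0u |-> 0(u^g0), 1u |-> 1(u^g1) *)
Definition aut_pair (g0 g1 : tree_aut) : tree_aut.
Proof.
apply: (@TreeAut (pair_fun g0 g1) (pair_fun (aut_inv g0) (aut_inv g1))) => //.
- by case=> //= -[] u; rewrite aut_funK.
- by case=> //= -[] u; rewrite aut_invK.
- case=> [|[] u] x /=; first by exists x; case: x; rewrite aut_root.
  + by have [y ->] := aut_child g1 u x; exists y.
  + by have [y ->] := aut_child g0 u x; exists y.
Defined.

(* [gen_b w j] is b_{j+1}, and y_{j+1} is [nth false w j]. *)
Fixpoint gen_b (w : seq bool) (j : nat) : tree_aut :=
  if j is j'.+1
  then if nth false w j' then aut_pair 1 (gen_b w j')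
       else aut_pair (gen_b w j') 1
  else aut_sigma.

(* The recursion defining a_1, ..., a_n is circular through a_1 and a_n, so
   the action is defined by recursion on the word acted upon; [bk] is the
   action of b_k.  Index i stands for a_{i+1}.  Only y_k is tested in a_1, as
   x_n is meant to be the other letter.  That the resulting
   automorphisms satisfy the recursion, and are the only ones to do so, is
   [gen_a_rec0], [gen_a_recS] and [gen_a_unique]. *)
Fixpoint a_fun (w v : seq bool) (bk : seq bool -> seq bool) (i : nat)
    (u : seq bool) {struct u} : seq bool :=
  if u is z :: u' then
    z :: (if i is i'.+1
          then if z == nth false v i' then a_fun w v bk i' u' else u'
          else if z == last false w then bk u'
               else a_fun w v bk (size v).-1 u')
  else [::].

Definition gen_a (w v : seq bool) (i : nat) : tree_aut.
Proof.
pose bk := gen_b w (size w).-1.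
apply: (@TreeAut (a_fun w v bk i) (a_fun w v (aut_inv bk) i)) => //.
- move=> u; elim: u i => //= z u IHu [|i]; congr (_ :: _); case: (z == _) => //.
  by rewrite aut_funK.
- move=> u; elim: u i => //= z u IHu [|i]; congr (_ :: _); case: (z == _) => //.
  by rewrite aut_invK.
- move=> u x; elim: u i => [|z u IHu] [|i] /=.
  + by exists x; case: ifP => //; rewrite aut_root.
  + by exists x; case: ifP.
  + case: ifP => _; last by have [y ->] := IHu (size v).-1; exists y.
    by have [y ->] := aut_child bk u x; exists y.
  + case: ifP => _; last by exists x.
    by have [y ->] := IHu i; exists y.
Defined.

Lemma gen_a_rec0 (w v : seq bool) :
  gen_a w v 0 =
  if last false w then aut_pair (gen_a w v (size v).-1) (gen_b w (size w).-1)
  else aut_pair (gen_b w (size w).-1) (gen_a w v (size v).-1).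
Proof. by case: ifP => lw; apply: tree_autP => -[|[] u] //=; rewrite lw. Qed.

Lemma gen_a_recS (w v : seq bool) (i : nat) :
  gen_a w v i.+1 =
  if nth false v i then aut_pair 1 (gen_a w v i) else aut_pair (gen_a w v i) 1.
Proof. by case: ifP => lw; apply: tree_autP => -[|[] u] //=; rewrite lw. Qed.

Lemma gen_a_unique (w v : seq bool) (a : nat -> tree_aut) :
    v != [::] ->
    a 0 = (if last false w then aut_pair (a (size v).-1) (gen_b w (size w).-1)
           else aut_pair (gen_b w (size w).-1) (a (size v).-1)) ->
    (forall i, (i.+1 < size v)%N ->
       a i.+1 = if nth false v i then aut_pair 1 (a i) else aut_pair (a i) 1) ->
  forall i, (i < size v)%N -> a i = gen_a w v i.
Proof.
move=> v0 a0 aS i iv; apply: tree_autP => u; elim: u i iv => [|z u IHu] i iv.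
  by rewrite !aut_root.
have nv : ((size v).-1 < size v)%N by case: (v) v0.
case: i iv => [|i] iv.
- by rewrite a0 gen_a_rec0; case: ifP => _; case: z => //=; rewrite IHu.
- rewrite aS // gen_a_recS; case: ifP => _; case: z => //=.
    by rewrite IHu // ltnW.
  by rewrite IHu // ltnW.
Qed.

Local Open Scope classical_set_scope.

Definition subgroup_gen (S : set tree_aut) : set tree_aut :=
  smallest [set H : set tree_aut | group_closed (mem H)] S.

Definition K_group (w v : seq bool) : set tree_aut :=
  subgroup_gen ([set gen_b w j | j in [set j | (j < size w)%N]]
         `|` [set gen_a w v i | i in [set i | (i < size v)%N]]).

Definition has_order (g : tree_aut) (m : nat) : Prop :=
  [/\ (0 < m)%N, g ^+ m = 1
    & forall d : nat, (0 < d)%N -> (d < m)%N -> g ^+ d <> 1].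

Definition embeds_in (gT : finGroupType) (G : {group gT})
    (K : set tree_aut) : Prop :=
  exists f : gT -> tree_aut,
    [/\ {in G &, {morph f : x y / x * y}}, {in G &, injective f}
      & forall x, x \in G -> K (f x)].

(* Main.v *)
Require Import Defs.
From mathcomp Require Import all_boot all_fingroup all_solvable.
From mathcomp Require Import zify zmodp.
From mathcomp Require Import boolp classical_sets.

Set Implicit Arguments.
Unset Strict Implicit.
Unset Printing Implicit Defensive.

(** Write K for the group, K' and K'' for its derived subgroups, [pair_at x g h]
    for the automorphism acting by g below the letter x and by h below the other
    letter, and [below u g] for the copy of g acting below the vertex u.
    Comments number the generators from 1, so that b_j is [gen_b w j.-1] and a_i
    is [gen_a w v i.-1]; k and n are the lengths of w and v.

    Branching.  Every generator of K is the section at x of some generator or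
    of its conjugate by sigma; the other section is 1, except that b_k and a_n
    occur together, as the two sections of a_1.  So each g in K lifts to an
    element [pair_at x g d] of K with d in the subgroup D generated by b_k and
    a_n ([K_lifts_to]).  Lifting commutators by commutators, each g in K'' lifts
    to an element [pair_at x g d] of K'' with d in D''.  But D is generated by
    two involutions, hence dihedral, hence metabelian: D'' = 1
    ([derived2_dihedral]).  Therefore K'' contains [pair_at x g 1], and so
    [below u g], for all g in K'' ([derived2_K_pair]).

    Wreath products.  Let L be a subgroup closed under all the maps [below u]
    that contains an involution t, and let u be a vertex moved by t.  For a
    subgroup H of L, the elements [below u h] form a copy of H in L which
    commutes with its conjugate by t, so that L contains the wreath product of
    H with the group of order two.  A finite 2-group with a subgroup M of index
    two embeds into the wreath product of M with the group of order two, and by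
    induction on the order L contains every finite 2-group ([embeds_2group]).

    An involution in K''.  What remains is to exhibit one; this is where the
    case of two words of length 1, in which K itself is dihedral, drops out.
    If a is an involution then [[a, s], a] is the inverse square of [a, s].
    For k > 1 this yields an involution of K'' as soon as some element
    [pair_at x s0 s1] of K has s1^-1 s0 of order 4 ([torsion_of_order4]).
    Elements of order 4 arise as products of sigma with an involution
    [pair_at x g h] where g and h are distinct and commute; they are found
    separately for k > 2, for n > 1 and for k = 2, n = 1.  For k = 1 the
    involution is a copy of [[a_1, sigma], a_1].

    Elements of large order come from the cyclic groups of order a power of
    two. *)

Local Open Scope group_scope.

(** * Pairs of automorphisms and copies below a vertex *)

Local Notation sigma := aut_sigma.

(** Indexing the two sections by a letter x and its negation, instead of by
    0 and 1, makes one computation serve both values of each letter of the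
    words. *)
Definition pair_at (x : bool) (g h : tree_aut) : tree_aut :=
  if x then aut_pair h g else aut_pair g h.

Fixpoint below (u : seq bool) (g : tree_aut) : tree_aut :=
  if u is x :: u' then pair_at x (below u' g) 1 else g.

Lemma autM (g h : tree_aut) z : (g * h) z = h (g z).
Proof. by []. Qed.

Lemma aut_inj (g : tree_aut) : injective g.
Proof. exact: can_inj (aut_funK g). Qed.

Lemma pair_atM x g h g' h' :
  pair_at x g h * pair_at x g' h' = pair_at x (g * g') (h * h').
Proof. by case: x; apply: tree_autP => -[|[] z]. Qed.

Lemma pair_at1 x : pair_at x 1 1 = 1.
Proof. by case: x; apply: tree_autP => -[|[] z]. Qed.

Lemma pair_atV x g h : (pair_at x g h)^-1 = pair_at x g^-1 h^-1.
Proof. by apply: mulg1_eq; rewrite pair_atM !mulgV pair_at1. Qed.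

Lemma pair_atR x g h g' h' :
  [~ pair_at x g h, pair_at x g' h'] = pair_at x [~ g, g'] [~ h, h'].
Proof. by rewrite !commgEl !conjgE !pair_atV !pair_atM. Qed.

Lemma pair_at_negb x g h : pair_at (~~ x) g h = pair_at x h g.
Proof. by case: x. Qed.

Lemma pair_at_inj x g h g' h' :
  pair_at x g h = pair_at x g' h' -> g = g' /\ h = h'.
Proof.
move=> e; split; apply: tree_autP => z.
  by have := congr1 (fun f : tree_aut => f (x :: z)) e; case: (x) => -[].
by have := congr1 (fun f : tree_aut => f (~~ x :: z)) e; case: (x) => -[].
Qed.

Lemma sigma2 : sigma * sigma = 1.
Proof. by apply: tree_autP => -[|[] z]. Qed.

Lemma sigmaV : sigma^-1 = sigma.
Proof. exact/mulg1_eq/sigma2. Qed.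

Lemma sigma_neq1 : sigma <> 1.
Proof. by move=> /(congr1 (fun f : tree_aut => f [:: true])). Qed.

Lemma pair_at_sigma x g h : pair_at x g h * sigma = sigma * pair_at x h g.
Proof. by case: x; apply: tree_autP => -[|[] z]. Qed.

Lemma pair_atJsigma x g h : pair_at x g h ^ sigma = pair_at x h g.
Proof. by rewrite conjgE pair_at_sigma mulKg. Qed.

Lemma commg_sigma x g h :
  [~ sigma, pair_at x g h] = pair_at x (h^-1 * g) (g^-1 * h).
Proof. by rewrite commgEr pair_atV pair_atJsigma pair_atM. Qed.

Definition involution (g : tree_aut) : Prop := g * g = 1 /\ g <> 1.

Lemma involutionV g : involution g -> g^-1 = g.
Proof. by case=> gg _; exact: mulg1_eq. Qed.

Lemma involution_sigma : involution sigma.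
Proof. split; [exact: sigma2 | exact: sigma_neq1]. Qed.

Lemma involution_pair_at x g h :
  involution g -> h * h = 1 -> involution (pair_at x g h).
Proof.
move=> [gg g1] hh; split; first by rewrite pair_atM gg hh pair_at1.
by rewrite -[1](pair_at1 x) => /pair_at_inj[].
Qed.

(** * Subgroups and derived subgroups *)

Lemma subgroup_gen_sub (S : set tree_aut) g : S g -> subgroup_gen S g.
Proof. exact: sub_gen_smallest. Qed.

Lemma subgroup_gen_ind (S : set tree_aut) (H : tree_aut -> Prop) :
    (forall g, S g -> H g) -> H 1 ->
    (forall g h, H g -> H h -> H (g * h^-1)) ->
  forall g, subgroup_gen S g -> H g.
Proof.
move=> SH H1 Hdiv; apply: (@smallest_sub _ _ _ (H : set tree_aut)) => //.
split; first exact/mem_set.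
by move=> g h /set_mem Hg /set_mem Hh; apply/mem_set/Hdiv.
Qed.

Lemma subgroup_gen_closed (S : set tree_aut) :
  group_closed (mem (subgroup_gen S)).
Proof.
split; first by apply/mem_set => H [[/set_mem H1 _] _].
move=> g h /set_mem Sg /set_mem Sh; apply/mem_set => H HS.
have [[_ Hdiv] _] := HS.
by apply/set_mem/Hdiv; apply/mem_set; [apply: Sg | apply: Sh].
Qed.

Lemma closed1 (L : set tree_aut) : group_closed (mem L) -> L 1.
Proof. by case=> /set_mem. Qed.

Lemma closedV (L : set tree_aut) (cL : group_closed (mem L)) g :
  L g -> L g^-1.
Proof. by move=> /mem_set Lg; apply/set_mem/(group_closedV cL). Qed.

Lemma closedM (L : set tree_aut) (cL : group_closed (mem L)) g h :
  L g -> L h -> L (g * h).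
Proof. by move=> /mem_set Lg /mem_set Lh; apply/set_mem/(group_closedM cL). Qed.

Lemma closedJ (L : set tree_aut) (cL : group_closed (mem L)) g h :
  L g -> L h -> L (g ^ h).
Proof.
move=> Lg Lh; rewrite conjgE.
by do !apply: closedM => //; apply: closedV.
Qed.

Definition derived (S : set tree_aut) : set tree_aut :=
  subgroup_gen [set z | exists g h, [/\ S g, S h & z = [~ g, h]]].

Notation derived2 S := (derived (derived S)).

Lemma derivedR (S : set tree_aut) g h : S g -> S h -> derived S [~ g, h].
Proof. by move=> Sg Sh; apply: subgroup_gen_sub; exists g, h. Qed.

Lemma derived_sub (S : set tree_aut) :
  group_closed (mem S) -> forall g, derived S g -> S g.
Proof.
move=> cS; apply: subgroup_gen_ind.
- move=> _ [g [h [Sg Sh ->]]]; rewrite commgEl.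
  by apply: closedM => //; [apply: closedV | apply: closedJ].
- exact: closed1.
- by move=> g h Sg Sh; apply: closedM => //; apply: closedV.
Qed.

(** The products of evenly many generators form the cyclic group E generated by
    p * q, and conjugation by p maps E to itself.  Commutators are products of
    evenly many generators, and E is abelian. *)
Lemma derived2_dihedral p q : p * p = 1 -> q * q = 1 ->
  forall g, derived2 (subgroup_gen [set p; q]) g -> g = 1.
Proof.
move=> pp qq.
have pV : p^-1 = p by exact: mulg1_eq.
have qV : q^-1 = q by exact: mulg1_eq.
pose E := subgroup_gen [set p * q].
have cE : group_closed (mem E) := subgroup_gen_closed _.
have E1 : E 1 := closed1 cE.
have abE g h : E g -> E h -> commute g h.
  move=> Eg; move: h; apply: subgroup_gen_ind.
  - move=> _ ->; apply: commute_sym; move: g Eg; apply: subgroup_gen_ind.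
    + by move=> _ ->; exact: commute_refl.
    + exact: commute1.
    + by move=> g h cg ch; apply: commuteM => //; apply: commuteV.
  - exact: commute1.
  - by move=> h h' ch ch'; apply: commuteM => //; apply: commuteV.
have EJ g : E g -> E (g ^ p).
  move: g; apply: subgroup_gen_ind.
  - move=> _ ->; have -> : (p * q) ^ p = (p * q)^-1.
      by rewrite conjgE invgM !mulgA pV qV pp mul1g.
    by apply: (closedV cE) => //; exact: subgroup_gen_sub.
  - by rewrite conj1g.
  - rewrite /= => g h Eg Eh; rewrite conjMg conjVg.
    by apply: (closedM cE) => //; exact: (closedV cE).
(* the products of oddly many generators *)
pose O g := E (g * p).
have OO g h : O g -> O h -> E (g * h).
  move=> Og /EJ; rewrite conjgE pV -[h * p * p]mulgA pp mulg1 => Eh.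
  by have := closedM cE Og Eh; rewrite !mulgA -[_ * p * p]mulgA pp mulg1.
have OV g : O g -> O g^-1.
  move=> /(closedV cE)/EJ; rewrite /O invgM pV conjgE pV !mulgA pp mul1g.
  by [].
have EO g h : E g -> O h -> O (g * h).
  by move=> Eg Oh; rewrite /O -mulgA; exact: (closedM cE).
have OE g h : O g -> E h -> O (g * h).
  move=> Og /EJ Eh; have := closedM cE Og Eh.
  by rewrite /O conjgE pV !mulgA -[_ * p * p]mulgA pp mulg1.
have DEO g : subgroup_gen [set p; q] g -> E g \/ O g.
  move: g; apply: subgroup_gen_ind.
  - move=> g [->|->]; right; first by rewrite /O pp.
    by have := closedV cE (subgroup_gen_sub (erefl (p * q)));
      rewrite invgM pV qV.
  - by left.
  - move=> g h [Eg|Og] [Eh|Oh].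
    + by left; apply: (closedM cE) => //; exact: (closedV cE).
    + by right; apply: EO => //; exact: OV.
    + by right; apply: OE => //; exact: (closedV cE).
    + by left; apply: OO => //; exact: OV.
have EDJ g h : E g -> subgroup_gen [set p; q] h -> E (g ^ h).
  move=> Eg /DEO[Eh|Oh]; first exact: (closedJ cE).
  by rewrite conjgE; apply: OO; [exact: OV | exact: EO].
have D'E g : derived (subgroup_gen [set p; q]) g -> E g.
  move: g; apply: subgroup_gen_ind.
  - move=> _ [g [h [Dg Dh ->]]].
    case: (DEO g Dg) => [Eg|Og].
      by rewrite commgEl; apply: (closedM cE) => //;
        [exact: (closedV cE) | exact: EDJ].
    case: (DEO h Dh) => [Eh|Oh].
      by rewrite commgEr; apply: (closedM cE) => //; apply: EDJ => //;
        exact: (closedV cE).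
    rewrite commgEl conjgE mulgA.
    by apply: (closedM cE) => //; apply: OO => //; exact: OV.
  - exact: E1.
  - by move=> g h Eg Eh; apply: (closedM cE) => //; exact: (closedV cE).
apply: subgroup_gen_ind => [_ [g [h [/D'E Eg /D'E Eh ->]]]||g h -> ->] //.
  by apply/eqP/commgP/abE.
by rewrite mulgV.
Qed.

(** The set B measures how far A is from containing its own copies below each
    letter: it contains them when B is trivial. *)
Definition lifts_to (A B : set tree_aut) : Prop :=
  forall x g, A g -> exists2 d, B d & A (pair_at x g d).

Lemma lifts_to_gen (S B : set tree_aut) : group_closed (mem B) ->
    (forall x g, S g -> exists2 d, B d & subgroup_gen S (pair_at x g d)) ->
  lifts_to (subgroup_gen S) B.
Proof.
move=> cB lS x; have cS := subgroup_gen_closed S; apply: subgroup_gen_ind.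
- exact: lS.
- by exists 1; rewrite ?pair_at1; [exact: closed1 | exact: (closed1 cS)].
- move=> g h [c Bc Sc] [d Bd Sd]; exists (c * d^-1).
    by apply: closedM => //; exact: closedV.
  by rewrite -pair_atM -pair_atV; apply: (closedM cS) => //;
    exact: (closedV cS).
Qed.

(** A commutator of lifts lifts the commutator.  This is how branching is
    obtained: the derived subgroups of B decrease to the trivial group. *)
Lemma lifts_to_derived (A B : set tree_aut) :
  lifts_to A B -> lifts_to (derived A) (derived B).
Proof.
move=> AB; apply: lifts_to_gen; first exact: subgroup_gen_closed.
move=> x _ [g [h [Ag Ah ->]]].
have [c Bc Ac] := AB x g Ag; have [d Bd Ad] := AB x h Ah.
by exists [~ c, d]; [exact: derivedR | rewrite -pair_atR; exact: derivedR].
Qed.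

(** * Embedding 2-groups in branching groups *)

Lemma size_aut (g : tree_aut) u : size (g u) = size u.
Proof.
elim/last_ind: u => [|u x IHu]; first by rewrite aut_root.
by have [y ->] := aut_child g u x; rewrite !size_rcons IHu.
Qed.

Lemma aut_cat (g : tree_aut) u z : exists z', g (u ++ z) = g u ++ z'.
Proof.
elim/last_ind: z => [|z x [z' IHz]]; first by exists [::]; rewrite !cats0.
have [y e] := aut_child g (u ++ z) x; exists (rcons z' y).
by rewrite -rcons_cat e IHz rcons_cat.
Qed.

Lemma belowM u g h : below u (g * h) = below u g * below u h.
Proof. by elim: u => //= x u ->; rewrite pair_atM mulg1. Qed.

Lemma below_cat u g z : below u g (u ++ z) = u ++ g z.
Proof. by elim: u => //= x u IHu; case: (x) => /=; rewrite IHu. Qed.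

Lemma below_out u g z : ~~ prefix u z -> below u g z = z.
Proof.
elim: u z => [|x u IHu] [|z0 z] //; first by rewrite aut_root.
by case: x z0 => [] [] //= /IHu ->.
Qed.

Lemma below_mem (L : set tree_aut) :
  L 1 -> (forall x g, L g -> L (pair_at x g 1)) ->
  forall u g, L g -> L (below u g).
Proof. by move=> L1 Lb; elim=> //= x u IHu g Lg; apply/Lb/IHu. Qed.

(** The conjugate by t is supported below the vertex t u, which has the same
    level as u and differs from it. *)
Lemma moved_below_fix (t : tree_aut) u h : t * t = 1 -> t u <> u ->
  forall z, prefix u z -> (below u h ^ t) z = z.
Proof.
move=> tt tu z /prefixP[z' ->]; have tV := mulg1_eq tt.
have tK y : t (t y) = y by rewrite -autM tt.
rewrite conjgE tV !autM below_out ?tK //.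
have [y ->] := aut_cat t u z'; rewrite prefixE take_size_cat ?size_aut //.
exact/eqP.
Qed.

Lemma below_moved_commute (t : tree_aut) u g h :
  t * t = 1 -> t u <> u -> commute (below u g) (below u h ^ t).
Proof.
move=> tt tu; move: (moved_below_fix h tt tu).
move: (below u h ^ t) => c cK; apply: tree_autP => z; rewrite !autM.
have [uz|nuz] := boolP (prefix u z).
  rewrite [c z]cK //; move/prefixP: uz => [z' ->].
  by rewrite below_cat cK // prefix_prefix.
rewrite (below_out _ nuz) below_out //.
by apply: contra nuz => uz; have /aut_inj <- := cK _ uz.
Qed.

Lemma mem_index2M (gT : finGroupType) (G H : {group gT}) x y :
    H \subset G -> #|G : H|%g = 2 -> x \in G -> y \in G ->
  (x * y \in H) = ((x \in H) == (y \in H)).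
Proof.
move=> sHG iH Gx Gy; have [Hx|nHx] := boolP (x \in H); first exact: groupMl.
have [Hy|nHy] := boolP (y \in H); first by rewrite groupMr ?(negbTE nHx).
rewrite eqxx -[y]invgK -mem_rcoset (rcoset_index2 sHG iH) inE ?nHx //.
by rewrite !groupV nHy.
Qed.

(** This is the embedding of H into the wreath product of M with the group of
    order two.  Fix s outside M.  For i = 0 and 1 write s^i h = m_i s^j with
    m_i in M and j equal to 0 or 1: then m_0 and m_1 are the coordinates of the
    image of h, and j = i exactly when h lies in M. *)
Lemma embeds_index2 (L : set tree_aut) (t : tree_aut) (gT : finGroupType)
    (H M : {group gT}) :
    group_closed (mem L) -> (forall x g, L g -> L (pair_at x g 1)) ->
    L t -> involution t -> M \subset H -> #|H : M|%g = 2 ->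
  embeds_in M L -> embeds_in H L.
Proof.
move=> cL Lb Lt [tt t1] sMH iM [f [fM fI fL]].
have tV := mulg1_eq tt.
have [u tu] : exists u, t u <> u.
  by apply: contra_notP t1 => /forallNP tu; apply: tree_autP => u;
     apply/not_notP.
have subMH (x : gT) : x \in M -> x \in H := fintype.subsetP sMH x.
have [s Hs nMs] : exists2 s, s \in H & s \notin M.
  by apply/fintype.subsetPn; rewrite -indexg_eq1 iM.
have memM (x y : gT) : x \in H -> y \in H ->
    (x * y \in M) = ((x \in M) == (y \in M)).
  exact: mem_index2M.
have Ms x : x \in H -> x \notin M -> x * s^-1 \in M.
  by move=> Hx nMx; rewrite memM ?groupV // (negbTE nMx) (negbTE nMs).
have sM x : x \in H -> x \notin M -> s * x \in M.
  by move=> Hx nMx; rewrite memM // (negbTE nMx) (negbTE nMs).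
have sMs x : x \in M -> s * x * s^-1 \in M.
  move=> Mx; have Hx := subMH x Mx.
  have nsx : s * x \notin M by rewrite memM // Mx (negbTE nMs).
  have Hsx : s * x \in H by exact: groupM.
  by rewrite memM ?groupV // (negbTE nsx) (negbTE nMs).
(* the base group M x M of the wreath product *)
pose e m0 m1 := below u (f m0) * below u (f m1) ^ t.
have Ct g h := below_moved_commute g h tt tu.
have Le m0 m1 : m0 \in M -> m1 \in M -> L (e m0 m1).
  move=> M0 M1; have Lf m : m \in M -> L (below u (f m)).
    by move=> Mm; apply: (below_mem (closed1 cL) Lb); exact: fL.
  by apply: closedM => //; [exact: Lf | apply: closedJ => //; exact: Lf].
have eM m0 m1 n0 n1 : m0 \in M -> m1 \in M -> n0 \in M -> n1 \in M ->
    e m0 m1 * e n0 n1 = e (m0 * n0) (m1 * n1).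
  move=> M0 M1 N0 N1; rewrite /e !fM // !belowM conjMg.
  move: (Ct (f n0) (f m1)); move: (_ ^ t) (_ ^ t) => c1 c2 cc.
  by rewrite -!mulgA; congr (_ * _); rewrite !mulgA cc.
have et m0 m1 : t * e m0 m1 = e m1 m0 * t.
  by rewrite [e m1 m0]Ct /e !conjgE tV !mulgA.
have f1 : f 1 = 1.
  by apply: (mulgI (f 1)); rewrite -fM ?group1 // !mulg1.
pose F h := if h \in M then e h (s * h * s^-1) else e (h * s^-1) (s * h) * t.
have FM : {in H &, {morph F : x y / x * y}}.
  move=> x y Hx Hy; rewrite /F memM //.
  have [Mx|nMx] := boolP (x \in M); have [My|nMy] := boolP (y \in M) => /=.
  - by rewrite eM ?sMs // !mulgA mulgVK.
  - by rewrite [_ * (_ * t)]mulgA eM ?sMs ?Ms ?sM // !mulgA mulgVK.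
  - rewrite -[_ * t * _]mulgA et [_ * (_ * t)]mulgA eM ?sMs ?Ms ?sM //.
    by rewrite !mulgA mulgVK.
  - rewrite -[_ * t * _]mulgA [t * _]mulgA et -[_ * t * t]mulgA tt mulg1.
    by rewrite eM ?Ms ?sM // !mulgA mulgVK.
have F1 : F 1 = 1.
  by apply: (mulgI (F 1)); rewrite -FM ?group1 // !mulg1.
have eu m0 m1 : m0 \in M -> e m0 m1 = 1 -> m0 = 1.
  move=> M0 e1; apply: fI; rewrite ?group1 // f1; apply: tree_autP => z.
  have : e m0 m1 (u ++ z) = u ++ z by rewrite e1.
  rewrite /e autM (below_cat u (f m0) z) moved_below_fix ?prefix_prefix //.
  by move=> /eqP; rewrite eqseq_cat // eqxx => /eqP.
have et1 m0 m1 : e m0 m1 * t <> 1.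
  move=> et1; have : (e m0 m1 * t) u = u by rewrite et1.
  rewrite autM /e autM.
  have -> : below u (f m0) u = u.
    by have := below_cat u (f m0) [::]; rewrite aut_root cats0.
  by rewrite moved_below_fix // prefix_refl.
have FI z : z \in H -> F z = 1 -> z = 1.
  by move=> Hz; rewrite /F; case: ifP => [Mz /eu -> //| _ /et1].
exists F; split=> // [x y Hx Hy Fxy | x Hx].
  apply/divg1_eq/FI; first by rewrite groupM ?groupV.
  apply: (mulIg (F y)); rewrite -FM ?groupM ?groupV // mulgVK mul1g.
  exact: Fxy.
rewrite /F; have [Mx|nMx] := boolP (x \in M).
  by apply: Le => //; exact: sMs.
by apply: closedM => //; apply: Le; [exact: Ms | exact: sM].
Qed.

(** Induction on the order: a nontrivial 2-group has a subgroup of index 2. *)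
Lemma embeds_2group (L : set tree_aut) (t : tree_aut) :
    group_closed (mem L) -> (forall x g, L g -> L (pair_at x g 1)) ->
    L t -> involution t ->
  forall (gT : finGroupType) (G : {group gT}), 2.-group G -> embeds_in G L.
Proof.
move=> cL Lb Lt it gT G; have [m] := ubnP #|G|.
elim: m G => // m IHm G ltGm pG.
have [G1|ntG] := eqVneq (G : {set gT}) 1.
  exists (fun=> 1); split=> [x y _ _|x y|x _]; rewrite ?mulg1 //.
    by rewrite G1 => /set1gP-> /set1gP->.
  exact: closed1.
have [M maxM] : {M : {group gT} | maximal M G}.
  by apply: ex_maxgroup; exists 1%G; rewrite proper1G.
have sMG := proper_sub (maxgroupp maxM).
apply: (embeds_index2 cL Lb Lt it sMG (p_maximal_index pG maxM)).
apply: IHm; last exact: pgroupS pG.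
exact: leq_trans (proper_card (maxgroupp maxM)) ltGm.
Qed.
(** * The generators and the branching of the second derived subgroup *)

Lemma gen_bS w j :
  gen_b w j.+1 = pair_at (nth false w j) (gen_b w j) 1.
Proof. by []. Qed.

Lemma gen_aS w v i :
  gen_a w v i.+1 = pair_at (nth false v i) (gen_a w v i) 1.
Proof. exact: gen_a_recS. Qed.

Lemma gen_a0 w v :
  gen_a w v 0 =
  pair_at (last false w) (gen_b w (size w).-1) (gen_a w v (size v).-1).
Proof. exact: gen_a_rec0. Qed.

Lemma involution_gen_b w j : involution (gen_b w j).
Proof.
elim: j => [|j IHj]; first exact: involution_sigma.
by rewrite gen_bS; apply: involution_pair_at => //; rewrite mulg1.
Qed.

Lemma gen_a2 w v i : gen_a w v i * gen_a w v i = 1.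
Proof.
apply: tree_autP => u; elim: u i => [|z u IHu] i; first by rewrite aut_root.
case: i => [|i].
  rewrite gen_a0 pair_atM (involution_gen_b w _).1.
  by case: (last _ _) z => [] [] //=; congr (_ :: _); exact: IHu.
rewrite gen_aS pair_atM mulg1.
by case: (nth _ _ _) z => [] [] //=; congr (_ :: _); exact: IHu.
Qed.

Lemma involution_gen_a w v i : involution (gen_a w v i).
Proof.
elim: i => [|i IHi].
  rewrite gen_a0; apply: involution_pair_at; last exact: gen_a2.
  exact: involution_gen_b.
by rewrite gen_aS; apply: involution_pair_at => //; rewrite mulg1.
Qed.

(** Conjugation by sigma exchanges the two sections. *)
Lemma pair_at_any (L : set tree_aut) : group_closed (mem L) -> L sigma ->
  forall x z g h, L (pair_at x g h) -> L (pair_at z g h).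
Proof.
move=> cL Ls x z g h; have [->//|] := eqVneq z x; rewrite eq_sym -addbT => nzx.
have -> : z = ~~ x by case: z x nzx => [] [].
by move=> Lx; rewrite pair_at_negb -pair_atJsigma; exact: (closedJ cL).
Qed.

Lemma K_closed w v : group_closed (mem (K_group w v)).
Proof. exact: subgroup_gen_closed. Qed.

Lemma K_gen_b w v j : (j < size w)%N -> K_group w v (gen_b w j).
Proof. by move=> jw; apply: subgroup_gen_sub; left; exists j. Qed.

Lemma K_gen_a w v i : (i < size v)%N -> K_group w v (gen_a w v i).
Proof. by move=> iv; apply: subgroup_gen_sub; right; exists i. Qed.

Lemma K_sigma w v : (0 < size w)%N -> K_group w v sigma.
Proof. exact: (@K_gen_b w v 0). Qed.

Lemma K_pair_b w v x j : (j.+1 < size w)%N ->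
  K_group w v (pair_at x (gen_b w j) 1).
Proof.
move=> jw; apply: (pair_at_any (K_closed w v) _ (x := nth false w j)).
  by apply: K_sigma; exact: leq_trans jw.
by rewrite -gen_bS; exact: K_gen_b.
Qed.

Lemma K_pair_a w v x i : (0 < size w)%N -> (i.+1 < size v)%N ->
  K_group w v (pair_at x (gen_a w v i) 1).
Proof.
move=> w0 iv; apply: (pair_at_any (K_closed w v) _ (x := nth false v i));
  first exact: K_sigma.
by rewrite -gen_aS; exact: K_gen_a.
Qed.

Lemma K_pair_ba w v x : (0 < size w)%N -> (0 < size v)%N ->
  K_group w v (pair_at x (gen_b w (size w).-1) (gen_a w v (size v).-1)).
Proof.
move=> w0 v0; apply: (pair_at_any (K_closed w v) _ (x := last false w));
  first exact: K_sigma.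
by rewrite -gen_a0; exact: K_gen_a.
Qed.

(** The generators b_k and a_n are the only ones that come with a nontrivial
    sibling section when lifted, namely with each other. *)
Definition K_sibling w v : set tree_aut :=
  subgroup_gen [set gen_b w (size w).-1; gen_a w v (size v).-1].

Lemma K_lifts_to w v : (0 < size w)%N -> (0 < size v)%N ->
  lifts_to (K_group w v) (K_sibling w v).
Proof.
move=> w0 v0; have cD : group_closed (mem (K_sibling w v)).
  exact: subgroup_gen_closed.
apply: lifts_to_gen => // x g [[j /= jw <-]|[i /= iv <-]].
- have [jk|] := ltnP j.+1 (size w).
    by exists 1; [exact: (closed1 cD) | exact: K_pair_b].
  move=> wj; have -> : j = (size w).-1 by lia.
  exists (gen_a w v (size v).-1); last exact: K_pair_ba.
  by apply: subgroup_gen_sub; right.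
- have [ik|] := ltnP i.+1 (size v).
    by exists 1; [exact: (closed1 cD) | exact: K_pair_a].
  move=> vi; have -> : i = (size v).-1 by lia.
  exists (gen_b w (size w).-1); first by apply: subgroup_gen_sub; left.
  by rewrite -pair_at_negb; exact: K_pair_ba.
Qed.

(** K'' is closed under [pair_at x _ 1] because the second derived subgroup of
    the dihedral group of sibling sections vanishes. *)
Lemma derived2_K_pair w v x g : (0 < size w)%N -> (0 < size v)%N ->
  derived2 (K_group w v) g ->
  derived2 (K_group w v) (pair_at x g 1).
Proof.
move=> w0 v0 Kg.
have [d D2d] := lifts_to_derived (lifts_to_derived (K_lifts_to w0 v0)) x Kg.
rewrite (derived2_dihedral _ _ D2d) //; last exact: gen_a2.
by case: (involution_gen_b w (size w).-1).
Qed.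

(** * An involution in the second derived subgroup *)

(** Conjugation by the involution a inverts [a, b]. *)
Lemma commg_involution (a b : tree_aut) : a * a = 1 ->
  [~ [~ a, b], a] = [~ a, b]^-1 * [~ a, b]^-1.
Proof.
move=> aa; have aV := mulg1_eq aa.
rewrite [LHS]commgEl; congr (_ * _).
by rewrite invgR !commgEl !conjgE aV !mulgA aa mul1g.
Qed.

(** Put s = [pair_at x s0 s1] and r = s1^-1 s0, an element of order 4.  Then
    [sigma, s] = [pair_at x r r^-1].  As b_2 is a copy of sigma when k > 1, both
    [pair_at x sigma sigma] and [pair_at x [sigma, s] 1] are commutators in K,
    and their commutator acts below x as the inverse square of [sigma, s]. *)
Lemma torsion_of_order4 w v x s0 s1 :
    (1 < size w)%N -> (0 < size v)%N -> K_group w v (pair_at x s0 s1) ->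
    involution ((s1^-1 * s0) * (s1^-1 * s0)) ->
  exists t, derived2 (K_group w v) t /\ involution t.
Proof.
move=> w1 v0 Ks; set r : tree_aut := s1^-1 * s0 => -[r4 r2].
have rVE : s0^-1 * s1 = r^-1 by rewrite invgM invgK.
have w0 : (0 < size w)%N by exact: ltnW.
have Kp : K_group w v (pair_at x sigma 1) by exact: (@K_pair_b w v x 0 w1).
have [d _ Kd] := K_lifts_to w0 v0 x Ks.
have K'ss : derived (K_group w v) (pair_at x sigma sigma).
  have := derivedR (K_sigma w0) Kp.
  by rewrite commg_sigma sigmaV invg1 mul1g mulg1.
have := derivedR Kp Kd; rewrite pair_atR comm1g => K'c.
have := derivedR K'c K'ss.
rewrite pair_atR comm1g (commg_involution _ sigma2) commg_sigma -/r rVE.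
rewrite pair_atV invgK pair_atM => K''.
set c := pair_at x _ 1 in K''; exists c; split => //.
have rV : r^-1 * r^-1 = r * r by rewrite -invgM; exact: mulg1_eq.
apply: involution_pair_at; last by rewrite mulg1.
by rewrite rV; apply: involution_pair_at.
Qed.

Lemma sqr_sigma_pair x g h :
  (sigma * pair_at x g h) * (sigma * pair_at x g h) =
  pair_at x (h * g) (g * h).
Proof.
rewrite -{1}pair_at_sigma -mulgA.
by rewrite [sigma * (_ * _)]mulgA sigma2 mul1g pair_atM.
Qed.

Lemma sqr_pair_sigma x g h :
  (pair_at x g h * sigma) * (pair_at x g h * sigma) =
  pair_at x (g * h) (h * g).
Proof.
by rewrite pair_at_sigma sqr_sigma_pair.
Qed.

(** The two sections of a_1 are b_k and a_n, and b_k is a copy of b_(k-1) below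
    some letter.  For k > 1 that letter can be chosen freely, up to conjugacy:
    conjugating by the copy of sigma below the letter where a_1 acts as b_k
    changes b_k to its conjugate by sigma and leaves a_n as it is. *)
Lemma K_pair_flip w v z : (1 < size w)%N -> (0 < size v)%N ->
  exists2 g, K_group w v g &
  pair_at (last false w) (pair_at z (gen_b w (size w).-2) 1)
    (gen_a w v (size v).-1) = gen_a w v 0 ^ g.
Proof.
move=> w1 v0; have cK := K_closed w v.
have Kp : K_group w v (pair_at (last false w) sigma 1).
  exact: (@K_pair_b w v _ 0 w1).
have bE : gen_b w (size w).-1 =
    pair_at (nth false w (size w).-2) (gen_b w (size w).-2) 1.
  by rewrite -gen_bS; congr gen_b; lia.
have [->|] := eqVneq z (nth false w (size w).-2).
  by exists 1; [exact: (closed1 cK) | rewrite conjg1 gen_a0 bE].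
move=> nz; exists (pair_at (last false w) sigma 1) => //.
rewrite gen_a0 conjgE pair_atV !pair_atM invg1 mul1g mulg1; congr pair_at.
rewrite -conjgE bE pair_atJsigma -pair_at_negb; congr pair_at.
by case: z (nth _ _ _) nz => [] [].
Qed.

(** The element of order 4 is sigma b_2, whose square acts as sigma below both
    letters. *)
Lemma derived2_K_involution_w3 w v : (2 < size w)%N -> (0 < size v)%N ->
  exists t, derived2 (K_group w v) t /\ involution t.
Proof.
move=> w2 v0; have w1 : (1 < size w)%N by exact: ltnW.
apply: (@torsion_of_order4 w v false (sigma * gen_b w 1) 1) => //.
  rewrite -[1]mulg1 -pair_atM; apply: (closedM (K_closed w v)).
    exact: (@K_pair_b w v _ 0).
  exact: (@K_pair_b w v _ 1).
rewrite invg1 mul1g gen_bS sqr_sigma_pair mul1g mulg1.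
by apply: involution_pair_at; [exact: involution_sigma | exact: sigma2].
Qed.

(** By [K_pair_flip] some conjugate of a_1 has sections b and a_n where b is a
    copy of b_(k-1) and a_n a copy of a_(n-1) below different letters.  They
    commute, so that sigma times this conjugate has order 4. *)
Lemma derived2_K_involution_w2v2 w v : (1 < size w)%N -> (1 < size v)%N ->
  exists t, derived2 (K_group w v) t /\ involution t.
Proof.
move=> w1 v1; have cK := K_closed w v.
have w0 : (0 < size w)%N by exact: ltnW.
have v0 : (0 < size v)%N by exact: ltnW.
pose z := nth false v (size v).-2.
have [g Kg gE] := K_pair_flip (~~ z) w1 v0.
have [d _ Kd] := K_lifts_to w0 v0 false Kg.
apply: (@torsion_of_order4 w v false (sigma * gen_a w v 0 ^ g) 1) => //.
  rewrite -[1]mulg1 -pair_atM; apply: (closedM cK).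
    exact: (@K_pair_b w v _ 0).
  have := closedJ cK (@K_pair_a w v false 0 w0 v1) Kd.
  by rewrite !conjgE pair_atV !pair_atM mul1g mulVg.
rewrite invg1 mul1g -gE sqr_sigma_pair.
have -> : gen_a w v (size v).-1 = pair_at z (gen_a w v (size v).-2) 1.
  by rewrite -gen_aS; congr gen_a; lia.
rewrite pair_at_negb !pair_atM !mul1g !mulg1.
have iu : involution (pair_at z (gen_a w v (size v).-2) (gen_b w (size w).-2)).
  apply: involution_pair_at; first exact: involution_gen_a.
  by case: (involution_gen_b w (size w).-2).
by apply: involution_pair_at => //; case: iu.
Qed.

(** Here a_1 has sections b_2 and a_1, and by [K_pair_flip] some conjugate of it
    has sections s0, a copy of sigma below the letter under which a_1 acts as
    b_2, and a_1.  So a_1 s0 has sections b_2 sigma, of order 4, and a_1. *)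
Lemma derived2_K_involution_w2v1 w v : size w = 2 -> size v = 1%N ->
  exists t, derived2 (K_group w v) t /\ involution t.
Proof.
move=> w2 v1; have cK := K_closed w v.
have w1 : (1 < size w)%N by rewrite w2.
have v0 : (0 < size v)%N by rewrite v1.
pose y := last false w.
have [g Kg] := K_pair_flip y w1 v0; rewrite -/y w2 v1 /= => gE.
apply: (@torsion_of_order4 w v y (pair_at y sigma 1) (gen_a w v 0)) => //.
  rewrite gE; apply: (closedJ cK) => //; exact: K_gen_a.
rewrite (involutionV (involution_gen_a w v 0)) gen_a0 -/y w2 v1.
rewrite [(2%N).-1]/= [(1%N).-1]/=.
rewrite gen_bS !pair_atM !mulg1 sqr_pair_sigma mul1g mulg1 gen_a2.
apply: involution_pair_at; last by rewrite mulg1.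
by apply: involution_pair_at; [exact: involution_sigma | exact: sigma2].
Qed.

(** For k = 1 the lifts of sigma = b_k have the section a_n next to it, whereas
    a_1 has isolated copies below either letter because n > 1; so a_1 takes over
    the part of sigma in [torsion_of_order4]: c = [a_1, sigma] has as sections
    sigma a_n and its inverse, of order 4, and the involution is a copy of
    [c, a_1] = c^-2. *)
Lemma derived2_K_involution_w1 w v : size w = 1%N -> (1 < size v)%N ->
  exists t, derived2 (K_group w v) t /\ involution t.
Proof.
move=> w1 v1; have cK := K_closed w v.
have w0 : (0 < size w)%N by rewrite w1.
have v0 : (0 < size v)%N by exact: ltnW.
pose a := gen_a w v 0; pose c := [~ a, sigma].
have aa : a * a = 1 by exact: gen_a2.
have Ka : K_group w v (pair_at false a 1) by exact: K_pair_a.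
have K'aa : derived (K_group w v) (pair_at false a a).
  have := derivedR (K_sigma w0) Ka.
  by rewrite commg_sigma invg1 mul1g mulg1 (mulg1_eq aa).
have K'c : derived (K_group w v) (pair_at false c 1).
  have := K_pair_ba false w0 v0; rewrite w1 /= => Kb.
  by have := derivedR Ka Kb; rewrite pair_atR comm1g.
exists (pair_at false [~ c, a] 1); split.
  by have := derivedR K'c K'aa; rewrite pair_atR comm1g.
apply: involution_pair_at; last by rewrite mulg1.
rewrite (commg_involution _ aa) -invgM.
suff icc : involution (c * c) by rewrite (involutionV icc).
have -> : c * c = a * sigma * (a * sigma) * (a * sigma * (a * sigma)).
  by rewrite /c commgEl conjgE (mulg1_eq aa) sigmaV !mulgA.
rewrite /a gen_a0 w1 [(1%N).-1]/= sqr_pair_sigma pair_atM.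
have -> : gen_a w v (size v).-1 =
    pair_at (nth false v (size v).-2) (gen_a w v (size v).-2) 1.
  by rewrite -gen_aS; congr gen_a; lia.
rewrite sqr_sigma_pair sqr_pair_sigma !mul1g !mulg1.
have iu := involution_gen_a w v (size v).-2; have [uu _] := iu.
have ip := involution_pair_at (nth false v (size v).-2) iu uu.
by apply: involution_pair_at => //; case: ip.
Qed.

(** * Conclusion *)

Lemma has_order_of_embeds (K : set tree_aut) :
    (forall (gT : finGroupType) (G : {group gT}),
      2.-group G -> embeds_in G K) ->
  forall N : nat, exists (g : tree_aut) (m : nat),
     [/\ K g, has_order g m & (N < m)%N].
Proof.
move=> emb N; pose n := (2 ^ N.+1)%N.
have n1 : (1 < n)%N by rewrite -[1%N](expn0 2) ltn_exp2l.
have pZ : 2.-group [set: 'Z_n].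
  by rewrite /pgroup cardsT card_ord Zp_cast // pnatX pnat_id.
have [f [fM fI fK]] := emb _ [set: 'Z_n]%G pZ.
have f1 : f 1 = 1 by apply: (mulgI (f 1)); rewrite -fM ?inE // !mulg1.
have fX (x : 'Z_n) i : f (x ^+ i) = f x ^+ i.
  by elim: i => [|i IHi]; rewrite ?expg0 // !expgS fM ?inE // IHi.
have oZ : #[Zp1 : 'Z_n] = n by rewrite order_Zp1 Zp_cast.
exists (f Zp1), n; split; first by apply: fK; rewrite inE.
  split=> [||d d0 dn]; first exact: ltnW.
    by rewrite -fX -[X in _ ^+ X]oZ expg_order.
  rewrite -fX -f1 => /fI -/(_ (finset.in_setT _) (finset.in_setT _)) /eqP.
  by rewrite -order_dvdn oZ gtnNdvd.
exact: ltn_trans (ltnSn N) (ltn_expl _ _).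
Qed.

Lemma derived2_K_involution w v : (0 < size w)%N -> (0 < size v)%N ->
    (1 < size w)%N \/ (1 < size v)%N ->
  exists t, derived2 (K_group w v) t /\ involution t.
Proof.
move=> w0 v0 wv.
have [w1|w1] : size w = 1%N \/ (1 < size w)%N by lia.
  by apply: derived2_K_involution_w1 => //; lia.
have [v1|v1] : size v = 1%N \/ (1 < size v)%N by lia.
  have [w2|w2] : size w = 2 \/ (2 < size w)%N by lia.
    exact: derived2_K_involution_w2v1.
  exact: derived2_K_involution_w3.
exact: derived2_K_involution_w2v2.
Qed.

Lemma embeds_2group_K w v : (0 < size w)%N -> (0 < size v)%N ->
    (1 < size w)%N \/ (1 < size v)%N ->
  forall (gT : finGroupType) (G : {group gT}),
  2.-group G -> embeds_in G (K_group w v).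
Proof.
move=> w0 v0 wv gT G pG.
have [t [K''t it]] := derived2_K_involution w0 v0 wv.
have K''_pair x g := @derived2_K_pair w v x g w0 v0.
have [f [fM fI fK]] :=
  embeds_2group (subgroup_gen_closed _) K''_pair K''t it pG.
exists f; split=> // x Gx; apply: (derived_sub (K_closed w v)).
by apply: derived_sub (fK x Gx); exact: subgroup_gen_closed.
Qed.

Local Close Scope group_scope.

Theorem proposition4p12 (w v : seq bool)
    (w_neq0 : w <> [::]) (v_neq0 : v <> [::])
    (last_neq : last false w <> last false v)
    (size_neq1 : size w <> 1 \/ size v <> 1) :
  (forall (gT : finGroupType) (G : {group gT}),
     (2.-group G)%g -> embeds_in G (K_group w v)) /\
  (forall N : nat, exists (g : tree_aut) (m : nat),
     [/\ K_group w v g, has_order g m & (N < m)%N]).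
Proof.
have w0 : 0 < size w by case: (w) w_neq0.
have v0 : 0 < size v by case: (v) v_neq0.
have wv : 1 < size w \/ 1 < size v by lia.
have emb := embeds_2group_K w0 v0 wv.
by split=> //; exact: has_order_of_embeds.
Qed.
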